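(* For every positive constant $b$ there exists a constant $c_b$, depending only on $b$, such that the following holds. Let $\Gamma_1,\Gamma_2,\Gamma_3$ be finite collections of curves in $\mathbb{R}^3$, such that, for $j=1,2,3$, each $\gamma\in\Gamma_j$ is parametrised by $t\mapsto(p_1^{\gamma}(t),p_2^{\gamma}(t),p_3^{\gamma}(t))$ for $t\in\mathbb{R}$, where $p_i^{\gamma}\in\mathbb{R}[t]$, $i=1,2,3$, are polynomials, not simultaneously constant, of degrees at most $b$. Let $J$ be the set of multijoints formed by $\Gamma_1,\Gamma_2$ and $\Gamma_3$. Then $$|J|\leq c_b\cdot (|\Gamma_1||\Gamma_2||\Gamma_3|)^{1/2}.$$
   Context: Let $\mathcal{F}$ be the family of all non-empty sets $\gamma\subseteq\mathbb{R}^3$ such that for every $x\in\gamma$ a basic neighbourhood of $x$ in $\gamma$ is either $\{x\}$ or a finite union of parametrised curves, each homeomorphic to a semi-open line segment with one endpoint the point $x$. If there is a parametrisation $f:[0,1)\to\mathbb{R}^3$ of one of these curves with $f(0)=x$ and $f'(0)\neq 0$, then the line through $x$ with direction $f'(0)$ is said to be tangent to $\gamma$ at $x$. Curves in $\mathbb{R}^3$ parametrised by real polynomials (i.e. images of such parametrisations) belong to $\mathcal{F}$. For $\Gamma\subset\mathcal{F}$, $T_x^{\Gamma}$ denotes the set of directions of all tangent lines at $x$ to the sets of $\Gamma$ passing through $x$. A point $x\in\mathbb{R}^3$ is a multijoint for (formed by) collections $\Gamma_1,\Gamma_2,\Gamma_3\subset\mathcal{F}$ if $x$ belongs to at least one of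 the sets in $\Gamma_i$ for all $i=1,2,3$, and there exists at least one vector $v_i\in T_x^{\Gamma_i}$ for each $i=1,2,3$ such that $\{v_1,v_2,v_3\}$ spans $\mathbb{R}^3$. *)

(* Defs.v *)
From HB Require Import structures.
From mathcomp Require Import all_boot all_order all_algebra finmap.
From mathcomp Require Import all_classical all_reals all_analysis.
Set Implicit Arguments.
Unset Strict Implicit.
Unset Printing Implicit Defensive.
Import Order.TTheory GRing.Theory Num.Theory.
Import numFieldNormedType.Exports.
Local Open Scope classical_set_scope.
Local Open Scope ring_scope.

(* [f] restricted to [0, 1) is a homeomorphism onto [C], the end point 0 being
   sent to [x]; the values of [f] outside [0, 1) are irrelevant. *)
Definition arc_parametrisation (R : realType) (x : 'rV[R]_3)
    (C : set 'rV[R]_3) (f : R -> 'rV[R]_3) : Prop :=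
  [/\ f 0 = x,
      f @` `[0, 1[ = C,
      {within `[0, 1[, continuous f} &
      exists g : 'rV[R]_3 -> R,
        {within C, continuous g} /\ {in `[0, 1[, cancel f g}].

Definition is_arc (R : realType) (x : 'rV[R]_3) (C : set 'rV[R]_3) : Prop :=
  exists f : R -> 'rV[R]_3, arc_parametrisation x C f.

(* The arcs in [Cs] are finitely many, start at [x], and their union is a
   neighbourhood of [x] in [gamma] for the subspace topology. Arbitrarily small
   ones are obtained by shortening the arcs, so smallness is not required: a
   shorter arc can be reparametrised on [0, 1) with the same tangent line. *)
Definition arc_neighbourhood (R : realType) (gamma : set 'rV[R]_3)
    (x : 'rV[R]_3) (Cs : set (set 'rV[R]_3)) : Prop :=
  [/\ finite_set Cs,
      forall C, Cs C -> is_arc x C,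
      \bigcup_(C in Cs) C `<=` gamma &
      within gamma (nbhs x) (\bigcup_(C in Cs) C)].

(* [f'(0)] is a one-sided derivative, [f] being a curve on [0, 1). *)
Definition tangent_direction (R : realType) (gamma : set 'rV[R]_3)
    (x v : 'rV[R]_3) : Prop :=
  v != 0 /\
  exists Cs C f, [/\ arc_neighbourhood gamma x Cs, Cs C,
    arc_parametrisation x C f &
    h^-1 *: (f h - f 0) @[h --> (0 : R)^'+] --> v].

Definition tangent_directions (R : realType) (Gamma : set (set 'rV[R]_3))
    (x : 'rV[R]_3) : set 'rV[R]_3 :=
  [set v | exists gamma, [/\ Gamma gamma, gamma x & tangent_direction gamma x v]].

Definition multijoint (R : realType) (Gamma : 'I_3 -> set (set 'rV[R]_3))
    (x : 'rV[R]_3) : Prop :=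
  (forall i, exists2 gamma, Gamma i gamma & gamma x) /\
  exists2 v : 'I_3 -> 'rV[R]_3,
    forall i, tangent_directions (Gamma i) x (v i) &
    (<<[seq v i | i <- enum 'I_3]>> = fullv)%VS.

(* [(size p).-1] is the degree of [p], with the convention that 0 has degree 0. *)
Definition polynomial_curve (R : realType) (b : R) (gamma : set 'rV[R]_3) : Prop :=
  exists p : 'I_3 -> {poly R},
    [/\ gamma = range (fun t : R => \row_i (p i).[t]),
        ~ (forall i, exists a : R, p i = a%:P) &
        forall i, ((size (p i)).-1)%:R <= b].

(* Main.v *)
(* Let J be a set of N multijoints; choose for each x in J and each j a curve of
   Gamma_j through x whose tangent directions at x form a basis, and put
   L_j = |Gamma_j|. Discarding points while some curve of Gamma_j is chosen by
   fewer than N / 4 L_j of those that remain leaves a nonempty subset S.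

   If N^2 > C L_1 L_2 L_3, linear algebra gives a polynomial Q <> 0, of degree
   less than N in each variable, whose derivative D_1^a1 D_2^a2 D_3^a3 along the
   tangent basis vanishes at x, for all x in J and all aj < Kj, where Kj is about
   B Lj. Let r be the minimal order of vanishing of Q on S, attained at x, so that
   some D_1^a1 D_2^a2 D_3^a3 Q (x) <> 0 with a1 + a2 + a3 = r. Then
   g = D_2^a2 D_3^a3 Q vanishes to order at least a1 at every point of S, but not
   identically on the first curve c through x, since its a1-th derivative in a
   tangent direction of c does not vanish at x. Counting the zeros of the
   univariate polynomial g o c at the points of S on c gives a1 N / 4 L_1 < 3 B N,
   hence a1 < K1. Likewise a2 < K2 and a3 < K3, which contradicts the choice
   of Q. *)
Require Import Defs.
From HB Require Import structures.
From mathcomp Require Import all_boot all_order all_algebra finmap.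
From mathcomp Require Import all_classical all_reals all_analysis.
From mathcomp Require Import zify ring lra.
From mathcomp Require mpoly.
Import Order.TTheory GRing.Theory Num.Theory.
Import numFieldNormedType.Exports.
Import -(notations) mpoly.
Local Open Scope classical_set_scope.
Local Open Scope ring_scope.
Set Implicit Arguments.
Unset Strict Implicit.
Unset Printing Implicit Defensive.

(** * Multiplicity of roots under differentiation *)

(** Characteristic 0 is used: if [p] = q (X - t)^(k+1) with q(t) nonzero and k < [a], then (X -
    t)^(k+1) divides p', hence also (k+1) q (X - t)^k, which forces q(t) = 0. *)
Lemma dvdp_exp_XsubC_deriv (F : numFieldType) (p : {poly F}) (t : F) (a : nat) :
  root p t -> ('X - t%:P) ^+ a %| p^`() -> ('X - t%:P) ^+ a.+1 %| p.
Proof.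
have [-> _ _|p0 pt dp] := eqVneq p 0; first exact: dvdp0.
have [k [q qt pE]] := multiplicity_XsubC p t.
rewrite p0 /= in qt.
case: k => [|k] in pE *.
  by move: pt; rewrite pE expr0 mulr1 (negbTE qt).
have [ak|ka] := leqP a k; first by rewrite pE dvdp_mull ?dvdp_exp2l.
exfalso; move: dp => /(dvdp_trans (dvdp_exp2l ('X - t%:P) ka)).
rewrite pE derivM dvdp_addr ?(dvdp_mull _ (dvdpp _)) //.
have -> : (('X - t%:P) ^+ k.+1)^`() = ('X - t%:P) ^+ k *+ k.+1.
  by rewrite deriv_exp derivXsubC mul1r.
rewrite mulrnAr -mulrnAl exprS dvdp_mul2r ?expf_neq0 ?polyXsubC_eq0 //.
rewrite dvdp_XsubCl rootE hornerMn mulrn_eq0 /=.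
by rewrite -rootE (negbTE qt).
Qed.

(** * Directional derivatives of multivariate polynomials *)

Section Algebra.
Context {F : numFieldType} {n : nat}.
Implicit Types (g h : mpoly n F) (x u v w : 'rV[F]_n) (c : 'I_n -> {poly F}).

Definition dderiv w g : mpoly n F := \sum_(i < n) w 0 i *: mderiv i g.

Lemma dderivE w g : dderiv w g = \sum_(i < n) w 0 i *: mderiv i g.
Proof. by []. Qed.

Lemma dderiv_is_linear w : linear (dderiv w).
Proof.
move=> a g h; rewrite /dderiv scaler_sumr -big_split /=.
apply: eq_bigr => i _; rewrite linearP /=.
by rewrite scalerDr !scalerA mulrC.
Qed.

HB.instance Definition _ w :=
  GRing.isLinear.Build F (mpoly n F) (mpoly n F) _ (dderiv w) (dderiv_is_linear w).

Lemma dderiv_suml (I : finType) (a : I -> F) (v : I -> 'rV[F]_n) g :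
  dderiv (\sum_i a i *: v i) g = \sum_i a i *: dderiv (v i) g.
Proof.
rewrite dderivE; transitivity (\sum_i \sum_j a i *: (v i 0 j *: mderiv j g)).
  rewrite exchange_big /=; apply: eq_bigr => j _.
  rewrite summxE scaler_suml; apply: eq_bigr => i _.
  by rewrite mxE scalerA.
by apply: eq_bigr => i _; rewrite dderivE scaler_sumr.
Qed.

Lemma dderiv_delta i g : dderiv (delta_mx 0 i) g = mderiv i g.
Proof.
rewrite /dderiv (bigD1 i) //= mxE !eqxx scale1r big1 ?addr0 // => j ji.
by rewrite mxE (negbTE ji) scale0r.
Qed.

Lemma dderivC u v g : dderiv u (dderiv v g) = dderiv v (dderiv u g).
Proof.
have E u' v' : dderiv u' (dderiv v' g) =
    \sum_i \sum_j (u' 0 i * v' 0 j) *: mderiv i (mderiv j g).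
  rewrite !dderivE; apply: eq_bigr => i _.
  rewrite (linear_sum (mderiv i)) scaler_sumr; apply: eq_bigr => j _.
  by rewrite linearZ_LR scalerA.
rewrite !E exchange_big; apply: eq_bigr => i _; apply: eq_bigr => j _ /=.
by rewrite mderiv_comm mulrC.
Qed.

(** A word of indices encodes an iterated derivative. As derivatives commute, only the number of
    occurrences of each letter matters. *)
Definition dderivs {I : Type} (v : I -> 'rV[F]_n) (s : seq I) g : mpoly n F :=
  foldr (fun j => dderiv (v j)) g s.

Lemma dderivs_is_linear (I : Type) (v : I -> 'rV[F]_n) s : linear (dderivs v s).
Proof. by elim: s => [|j s IH] a g h //=; rewrite IH linearP. Qed.

HB.instance Definition _ (I : Type) (v : I -> 'rV[F]_n) s :=
  GRing.isLinear.Build F (mpoly n F) (mpoly n F) _ (dderivs v s)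
    (dderivs_is_linear v s).

Lemma dderivs_dderiv (I : Type) (v : I -> 'rV[F]_n) s w g :
  dderivs v s (dderiv w g) = dderiv w (dderivs v s g).
Proof. by elim: s => //= j s ->; rewrite dderivC. Qed.

Lemma dderivs_cat (I : Type) (v : I -> 'rV[F]_n) s s' g :
  dderivs v (s ++ s') g = dderivs v s (dderivs v s' g).
Proof. exact: foldr_cat. Qed.

Lemma dderivs_perm (I : eqType) (v : I -> 'rV[F]_n) s s' g :
  perm_eq s s' -> dderivs v s g = dderivs v s' g.
Proof.
apply: (@catCA_perm_subst _ _ (dderivs v ^~ g)) => s1 s2 s3.
rewrite !dderivs_cat; move: (dderivs v s3 g) => h.
by elim: s1 h => [|j s1 IH] h //=; rewrite IH dderivs_dderiv.
Qed.

Lemma dderivs_nseq (I : Type) (v : I -> 'rV[F]_n) j a g :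
  dderivs v (nseq a j) g = iter a (dderiv (v j)) g.
Proof. by elim: a => //= a ->. Qed.

(** * Degree bounds and restriction to a polynomial curve *)

Definition bounded_degree (d : nat) g := forall m, mcoeff m g != 0 -> (mdeg m <= d)%N.

Lemma bounded_degree_mderiv d i g :
  bounded_degree d g -> bounded_degree d.-1 (mderiv i g).
Proof.
move=> dg m; rewrite mcoeff_mderiv => nz.
have /dg : mcoeff (mnm_add m (mnm1 i)) g != 0.
  by apply: contraNneq nz => ->; rewrite mul0rn.
rewrite mdegD mdeg1; lia.
Qed.

Lemma bounded_degree_dderiv d w g :
  bounded_degree d g -> bounded_degree d.-1 (dderiv w g).
Proof.
move=> dg m; rewrite dderivE raddf_sum /= => nz.
have [i nzi] : exists i, mcoeff m (mderiv i g) != 0.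
  apply/existsP; apply: contraNT nz; rewrite negb_exists => /forallP /= z.
  rewrite big1 // => i _; rewrite mcoeffZ.
  by have /negPn/eqP-> := z i; rewrite mulr0.
exact: bounded_degree_mderiv nzi.
Qed.

Lemma bounded_degree_dderivs (I : Type) (v : I -> 'rV[F]_n) s d g :
  bounded_degree d g -> bounded_degree d (dderivs v s g).
Proof.
move=> dg; elim: s => //= j s IH m /(bounded_degree_dderiv IH) /leq_trans; apply.
exact: leq_pred.
Qed.

Lemma size_mmap_polyC (B d : nat) c g :
  (forall i, (size (c i) <= B.+1)%N) -> bounded_degree d g ->
  (size (mmap (@polyC F) c g) <= (B * d).+1)%N.
Proof.
move=> sc dg; rewrite /mmap big_seq.
apply: (leq_trans (size_sum _ _ _)); apply/bigmax_leqP_seq => m mg _.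
rewrite mul_polyC; apply: leq_trans (size_scale_leq _ _) _.
rewrite /mmap1; have /dg md : mcoeff m g != 0 by rewrite -mcoeff_msupp.
apply: leq_trans (_ : (B * mdeg m).+1 <= _)%N; last by rewrite ltnS leq_mul2l md orbT.
rewrite mdegE big_distrr /=.
elim/big_rec2: _ => [|i p k _ IH]; first by rewrite size_poly1.
apply: leq_trans (size_polyMleq _ _) _.
have : (size (c i ^+ m i) <= (B * m i).+1)%N.
  apply: leq_trans (size_poly_exp_leq _ _) _.
  by rewrite ltnS leq_mul2r -subn1 leq_subLR add1n sc orbT.
by move: (size _) (size _) (B * m i)%N IH => *; lia.
Qed.

Lemma horner_mmap c g t :
  (mmap (@polyC F) c g).[t] = meval (fun i => (c i).[t]) g.
Proof.
rewrite mevalE /mmap horner_sum; apply: eq_bigr => m _.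
rewrite hornerM hornerC /mmap1 horner_prod; congr (_ * _).
by apply: eq_bigr => i _; rewrite horner_exp.
Qed.

(** Chain rule. The identity is stable under products, so it passes from 1 and the variables to
    monomials, and then by linearity to all polynomials. *)
Lemma deriv_mmap c g :
  (mmap (@polyC F) c g)^`() =
  \sum_(i < n) mmap (@polyC F) c (mderiv i g) * (c i)^`().
Proof.
pose good h := (mmap (@polyC F) c h)^`() =
  \sum_(i < n) mmap (@polyC F) c (mderiv i h) * (c i)^`().
have goodM h k : good h -> good k -> good (h * k).
  rewrite /good rmorphM derivM => -> ->.
  rewrite mulr_suml mulr_sumr -big_split; apply: eq_bigr => i _ /=.
  rewrite mderivM rmorphD !rmorphM /=; ring.
have good1 : good 1.
  rewrite /good rmorph1 derivC big1 // => i _.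
  by rewrite -mpolyC1 mderivC rmorph0 mul0r.
have goodX i : good (mpolyX F (mnm1 i)).
  rewrite /good mmapX mmap1U (bigD1 i) //= mderivX mnm1E eqxx.
  have -> : mnm_sub (mnm1 i) (mnm1 i) = mnm0.
    by apply/mnmP => j; rewrite mnmBE subnn mnm0E.
  rewrite mpolyX0 scale1r rmorph1 mul1r big1 ?addr0 // => j /negbTE ji.
  by rewrite mderivX mnm1E eq_sym ji scale0r rmorph0 mul0r.
have goodX_ m : good (mpolyX F m).
  rewrite mpolyXE_id; apply: big_ind => // i _.
  by elim: (m i) => [|k IH]; rewrite ?expr0 // exprS; apply: goodM.
rewrite -/(good g); elim/mpolyind: g => [|a m p _ _ IH].
  by rewrite /good rmorph0 derivC big1 // => i _; rewrite raddf0 rmorph0 mul0r.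
rewrite /good rmorphD /= mmapZ derivD derivM derivC mul0r add0r IH goodX_.
rewrite mulr_sumr -big_split; apply: eq_bigr => i _ /=.
rewrite linearP rmorphD /= mmapZ; ring.
Qed.

(** * Order of vanishing at a point *)

(** Order of vanishing at least [r]. Quantifying over all directions makes the notion independent of
    a basis. *)
Fixpoint vanishing (r : nat) x g : Prop :=
  if r is r'.+1 then
    meval (x 0) g = 0 /\ forall w, vanishing r' x (dderiv w g)
  else True.

Lemma vanishing_leq r r' x g : (r <= r')%N -> vanishing r' x g -> vanishing r x g.
Proof.
elim: r r' g => [|r IH] [|r'] g //= rr' [? H]; split=> // w.
exact: IH (H w).
Qed.

Lemma vanishing_dderiv r x w g : vanishing r x g -> vanishing r.-1 x (dderiv w g).
Proof. by case: r => //= r [_]. Qed.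

Lemma vanishing_dderivs (I : Type) (v : I -> 'rV[F]_n) s r x g :
  vanishing r x g -> vanishing (r - size s) x (dderivs v s g).
Proof.
move=> H; elim: s => [|j s IH] /=; first by rewrite subn0.
by rewrite subnS; apply: vanishing_dderiv.
Qed.

(** By the chain rule the derivative of g o c is a combination of the (mderiv i g) o c, to which the
    induction hypothesis applies; the root of g o c at [t] raises the exponent by one. *)
Lemma vanishing_dvdp a c t x g :
  (forall i, (c i).[t] = x 0 i) -> vanishing a x g ->
  ('X - t%:P) ^+ a %| mmap (@polyC F) c g.
Proof.
move=> cx; elim: a g => [|a IH] g /=; first by rewrite expr0 dvd1p.
case=> gx H; apply: dvdp_exp_XsubC_deriv.
  by rewrite rootE horner_mmap (meval_eq _ cx) gx.
rewrite deriv_mmap.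
apply: (big_ind (fun p => ('X - t%:P) ^+ a %| p)) => [|p q|i _]; rewrite ?dvdp0 //.
  exact: dvdp_add.
by apply: dvdp_mulr; apply: IH; rewrite -dderiv_delta.
Qed.

(** Iterated derivatives are multilinear in the directions, so it suffices to test directions from a
    spanning family, here the tangent basis at a joint. *)
Lemma vanishing_words (I : finType) (v : I -> 'rV[F]_n) r x g :
  (forall w, exists a : I -> F, w = \sum_i a i *: v i) ->
  (forall s, (size s < r)%N -> meval (x 0) (dderivs v s g) = 0) ->
  vanishing r x g.
Proof.
move=> span; elim: r g => [|r IH] g //= H; split; first exact: (H [::]).
move=> w; apply: IH => s sr; have [a ->] := span w.
rewrite dderiv_suml (linear_sum (dderivs v s)) raddf_sum big1 //= => i _.
rewrite (linearZ_LR (dderivs v s)) mevalZ.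
have := H (rcons s i); rewrite size_rcons ltnS /dderivs foldr_rcons => -> //.
by rewrite mulr0.
Qed.

(** The coefficient of a monomial containing the variable [i] reappears in the [i]-th partial
    derivative, times a nonzero integer. *)
Lemma mderiv_eq0 g : (forall i, mderiv i g = 0) -> g = mpolyC n (mcoeff mnm0 g).
Proof.
move=> z; apply/mpolyP => m; rewrite mcoeffC.
have [->|m0] := eqVneq m mnm0; rewrite ?mulr1 ?mulr0 //.
have [i mi] : exists i, (0 < m i)%N.
  apply/existsP; apply: contraNT m0; rewrite negb_exists => /forallP /= m0.
  by apply/eqP/mnmP => i; rewrite mnm0E; apply/eqP; rewrite -leqn0 leqNgt m0.
have /mpolyP/(_ (mnm_sub m (mnm1 i))) := z i; rewrite mcoeff_mderiv mcoeff0.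
have -> : mnm_add (mnm_sub m (mnm1 i)) (mnm1 i) = m.
  apply/mnmP => j; rewrite mnmDE mnmBE mnm1E.
  by case: eqVneq => [<-|_]; [rewrite subnK|rewrite subn0 addn0].
by move=> /eqP; rewrite mulrn_eq0 /= => /eqP.
Qed.

(** Induction on the degree: all partial derivatives are zero, so [g] is constant, equal to its
    value 0 at [x]. *)
Lemma vanishing_eq0 d x g : bounded_degree d g -> vanishing d.+1 x g -> g = 0.
Proof.
elim: d g => [|d IH] g dg [gx H].
all: have cst : (forall i, mderiv i g = 0) -> g = 0.
  1,3: move=> /mderiv_eq0 gE; move: gx.
  1,2: by rewrite gE mevalC => ->; rewrite mpolyC0.
  apply: cst => i; apply/mpolyP => m; rewrite mcoeff0.
  rewrite mcoeff_mderiv; have [->|/dg] := eqVneq (mcoeff (mnm_add m (mnm1 i)) g) 0.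
    by rewrite mul0rn.
  by rewrite mdegD mdeg1 addn1.
apply: cst => i; apply: IH; first exact: (@bounded_degree_mderiv d.+1).
by rewrite -dderiv_delta.
Qed.
End Algebra.

(** * Counting zeros of a univariate polynomial *)

Lemma prod_XsubC_exp_dvdp (F : fieldType) (p : {poly F}) (s : seq F) (a : nat) :
  uniq s -> (forall t, t \in s -> ('X - t%:P) ^+ a %| p) ->
  \prod_(t <- s) ('X - t%:P) ^+ a %| p.
Proof.
elim: s => [|t s IH] /= => [_ _|/andP[ts us] H]; first by rewrite big_nil dvd1p.
rewrite big_cons Gauss_dvdp.
  by rewrite H ?mem_head // IH // => u us'; rewrite H // inE us' orbT.
rewrite prodrXl coprimep_expl // coprimep_expr // coprimep_sym coprimep_XsubC.
by rewrite root_prod_XsubC.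
Qed.

Lemma size_exp_XsubC_dvdp (F : fieldType) (p : {poly F}) (s : seq F) (a : nat) :
  p != 0 -> uniq s -> (forall t, t \in s -> ('X - t%:P) ^+ a %| p) ->
  (a * size s <= (size p).-1)%N.
Proof.
move=> p0 us H; have /(dvdp_leq p0) := prod_XsubC_exp_dvdp us H.
have := size_exp (\prod_(t <- s) ('X - t%:P)) a.
rewrite prodrXl size_prod_XsubC /= mulnC => <-.
by case: (size _) => // k; case: (size p).
Qed.

(** * Parameter counting *)

(** There are D^n monomials with all exponents below [D], more than there are linear conditions. A
    nonzero row of the left kernel of the matrix of values of [phi] on these monomials gives the
    coefficients of [Q]. *)
Lemma exists_bounded_degree_killed (F : numFieldType) (n D : nat) (C : finType)
    (phi : C -> mpoly n F -> F) :
  (forall c a g h, phi c (a *: g + h) = a * phi c g + phi c h) ->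
  (#|C| < D ^ n)%N ->
  exists Q : mpoly n F,
    [/\ Q != 0, bounded_degree (n * D.-1) Q & forall c, phi c Q = 0].
Proof.
move=> phiL CD.
have phi0 c : phi c 0 = 0.
  have := phiL c 1 0 0; rewrite scaler0 addr0 mul1r => /eqP.
  by rewrite -subr_eq0 opprD addrA subrr sub0r oppr_eq0 => /eqP.
have phi_sum c (I : finType) (a : I -> F) (g : I -> mpoly n F) :
    phi c (\sum_i a i *: g i) = \sum_i a i * phi c (g i).
  elim/big_rec2: _ => [|i y z _ <-]; first exact: phi0.
  exact: phiL.
pose K : finType := {ffun 'I_n -> 'I_D}.
have cardK : #|K| = (D ^ n)%N by rewrite card_ffun !card_ord.
pose mon (k : K) : multinom n := Multinom (mktuple (fun i => nat_of_ord (k i))).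
have mon_inj : injective mon.
  move=> k l /mnmP kl; apply/ffunP => i; apply: val_inj => /=.
  by have := kl i; rewrite !mnmE.
pose M : 'M[F]_(#|K|, #|C|) :=
  \matrix_(i, j) phi (enum_val j) (mpolyX F (mon (enum_val i))).
have kerM : kermx M != 0.
  rewrite kermx_eq0 /row_free; apply: contraTN CD => /eqP rM.
  by rewrite -leqNgt -cardK -rM rank_leq_col.
have [i ui] : exists i, row i (kermx M) != 0.
  apply/existsP; apply: contraNT kerM; rewrite negb_exists => /forallP /= z.
  by apply/eqP/row_matrixP => i; rewrite row0; apply/eqP/negPn.
set u := row i (kermx M) in ui.
have uM : u *m M = 0 by apply/sub_kermxP; rewrite row_sub.
exists (\sum_j u 0 j *: mpolyX F (mon (enum_val j))).
have coef j :
    mcoeff (mon (enum_val j)) (\sum_j u 0 j *: mpolyX F (mon (enum_val j))) = u 0 j.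
  rewrite raddf_sum (bigD1 j) //= mcoeffZ mcoeffX eqxx mulr1 big1 ?addr0 // => k kj.
  by rewrite mcoeffZ mcoeffX (inj_eq mon_inj) (inj_eq enum_val_inj) (negbTE kj) mulr0.
split.
- apply: contraNneq ui => Q0; apply/eqP/rowP => j.
  by rewrite -coef Q0 mcoeff0 mxE.
- move=> m nz; have [j ->] : exists j : 'I_#|K|, m = mon (enum_val j).
    apply: contrapT => /forallNP mj; move: nz; rewrite raddf_sum big1 ?eqxx // => j _.
    rewrite /= mcoeffZ mcoeffX; case: eqP => [/esym/mj//|_]; exact: mulr0.
  rewrite mdegE -[leqRHS]/(n * D.-1)%N -[n in leqRHS]card_ord -sum_nat_const.
  apply: leq_sum => k _; rewrite mnmE -ltnS.
  exact: leq_trans (ltn_ord _) (leqSpred D).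
- move=> c; rewrite phi_sum.
  transitivity ((u *m M) 0 (enum_rank c)); last by rewrite uM mxE.
  by rewrite mxE; apply: eq_bigr => j _; rewrite [M _ _]mxE enum_rankK.
Qed.

(** * Discarding points on poor curves *)

(** The discarding process is replaced by a maximiser [S] of [f], the size of the set minus the
    weighted sizes of its images. Removing a fibre of [l i] lowers the weighted sum by at least
    [w i], so maximality makes the fibre at least that large. The weights are small enough that [f]
    is positive on the whole set, while it is at most 0 on the empty set. *)
Lemma exists_large_fibres (T : finType) (I : finType) (U : I -> finType)
    (l : forall i, T -> U i) :
  (0 < #|T|)%N ->
  exists2 S : {set T}, S != finset.set0 &
    forall x i, x \in S ->
      (#|T| <= #|I|.+1 * #|U i| * #|[set y in S | l i y == l i x]%SET|)%N.
Proof.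
move=> T0.
pose w i : rat := #|T|%:R / (#|I|.+1 * #|U i|)%:R.
have w_ge0 i : 0 <= w i by rewrite divr_ge0.
pose im i (S : {set T}) : rat := #|[set l i x | x in S]%SET|%:R.
pose f (S : {set T}) : rat := #|S|%:R - \sum_i w i * im i S.
have [S _ Smax] := @arg_maxP _ rat {set T} [set: T]%SET xpredT f isT.
exists S.
  apply: contraTneq (Smax [set: T]%SET isT) => ->; rewrite -ltNge.
  apply: (@le_lt_trans _ _ 0).
    by rewrite /f cards0 sub0r oppr_le0 sumr_ge0 // => i _; rewrite mulr_ge0.
  rewrite /f subr_gt0 cardsT.
  apply: (@le_lt_trans _ _ (\sum_(i : I) #|T|%:R / #|I|.+1%:R)).
    apply: ler_sum => i _; rewrite /w natrM invfM mulrA -[leLHS]mulrA.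
    rewrite ler_piMr ?divr_ge0 // mulrC.
    have [->|U0] := eqVneq #|U i| 0%N; first by rewrite invr0 mulr0.
    by rewrite ler_pdivrMr ?ltr0n ?lt0n // mul1r ler_nat max_card.
  rewrite sumr_const -[ltLHS]mulr_natr mulrAC -mulrA gtr_pMr ?ltr0n //.
  by rewrite ltr_pdivrMr ?ltr0n // mul1r ltr_nat.
move=> x i xS; set fib := [set y in S | _]%SET.
have im_le j : im j (S :\: fib)%SET <= im j S.
  by rewrite ler_nat subset_leq_card // imsetS // subsetDl.
have im_lt : im i (S :\: fib)%SET + 1 <= im i S.
  rewrite /im natr1 ler_nat (cardsD1 (l i x) [set l i y | y in S]%SET) imset_f //.
  rewrite add1n ltnS subset_leq_card //.
  apply/fintype.subsetP => _ /imsetP[y + ->]; rewrite !inE => /andP[+ yS].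
  by rewrite yS /= => -> /=; rewrite imset_f.
have fibS : fib \subset S by apply/fintype.subsetP => y; rewrite inE => /andP[].
have wi : w i <= #|fib|%:R.
  have /= := Smax (S :\: fib)%SET isT; rewrite /f cardsD (finset.setIidPr fibS).
  rewrite natrB ?subset_leq_card // => le_f.
  have : w i <= \sum_j w j * (im j S - im j (S :\: fib)%SET).
    rewrite (bigD1 i) //= -[leLHS]addr0 lerD //.
      by rewrite -[leLHS]mulr1 ler_wpM2l // lerBrDl.
    by rewrite sumr_ge0 // => j _; rewrite mulr_ge0 ?subr_ge0.
  under eq_bigr do rewrite mulrBr.
  by move: le_f; rewrite sumrB; lra.
have Ui : (0 < #|U i|)%N by apply/card_gt0P; exists (l i x).
move: wi; rewrite /w ler_pdivrMr ?ltr0n ?muln_gt0 //.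
by rewrite -natrM ler_nat mulnC.
Qed.

(** * Words as multi-indices *)

Section Words.
Context {I : finType}.
Implicit Types (m : I -> nat) (s : seq I).

Definition word m : seq I := flatten [seq nseq (m j) j | j <- enum I].

Lemma count_word m i : count_mem i (word m) = m i.
Proof.
rewrite /word count_flatten -map_comp sumnE big_map big_enum /=.
rewrite (bigD1 i) //= count_nseq /= eqxx mul1n big1 ?addn0 // => j /negbTE ji.
by rewrite count_nseq /= ji.
Qed.

Lemma perm_word s : perm_eq s (word (fun i => count_mem i s)).
Proof. by apply/allP => i _ /=; rewrite count_word. Qed.

(** Brings the letters [i] to the front, so that the derivatives in direction [i] are taken last. *)
Lemma perm_nseq_rest i s :
  perm_eq s (nseq (count_mem i s) i ++ [seq j <- s | j != i]).
Proof.
rewrite -(perm_filterC (pred1 i) s) perm_cat2r.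
have /all_pred1P -> : all (pred1 i) [seq x <- s | pred1 i x] by exact: filter_all.
by rewrite size_filter.
Qed.

End Words.

(** * The polynomial method for joints in dimension n *)

(** [T] is the set of joints, [U j] the [j]-th family of curves, and [l j x] the curve chosen at
    [x]. Tangency is expressed algebraically by the last hypothesis, which makes the [a1]-th
    derivative detect that g o c is nonzero. *)
Lemma joints_core (F : numFieldType) (n B : nat) (T : finType) (U : 'I_n -> finType)
    (l : forall j, T -> U j) (pt : T -> 'rV[F]_n) (v : T -> 'I_n -> 'rV[F]_n)
    (c : forall j, U j -> 'I_n -> {poly F}) :
  (0 < B)%N -> (0 < #|T|)%N -> injective pt ->
  (forall j u i, (size (c j u i) <= B.+1)%N) ->
  (forall x w, exists a, w = \sum_i a i *: v x i) ->
  (forall x j, exists t, forall i, (c j (l j x) i).[t] = pt x 0 i) ->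
  (forall x j a g, mmap (@polyC F) (c j (l j x)) g = 0 -> vanishing a (pt x) g ->
    meval (pt x 0) (iter a (dderiv (v x j)) g) = 0) ->
  (#|T| ^ n <= #|T| * \prod_(j < n) (n.+1 * n * B * #|U j|))%N.
Proof.
move=> B0 T0 pt_inj cB span onc tangent.
(* A fibre has at least N / ((n+1) |U j|) points, where N is the size of [T], and [Q] restricted to
   a curve has degree at most B n (N - 1); [K j] is the resulting bound on multiplicities. *)
pose K (j : 'I_n) := (n.+1 * n * B * #|U j|)%N.
rewrite leqNgt; apply/negP => small.
have [S /set0Pn[x0 x0S] fibS] := exists_large_fibres l T0.
pose C : finType := (T * {dffun forall j, 'I_(K j)})%type.
have cardC : #|C| = (#|T| * \prod_(j < n) K j)%N.
  rewrite card_prod card_dep_ffun foldrE big_map big_enum /=.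
  by congr (_ * _)%N; apply: eq_bigr => j _; rewrite card_ord.
pose phi (k : C) (Q : mpoly n F) : F :=
  meval (pt k.1 0) (dderivs (v k.1) (word (fun j => nat_of_ord (k.2 j))) Q).
have phiL k a g h : phi k (a *: g + h) = a * phi k g + phi k h.
  by rewrite /phi (linearP (dderivs _ _)) mevalD mevalZ.
have [Q [Q0 Qdeg Qphi]] : exists Q : mpoly n F,
    [/\ Q != 0, bounded_degree (n * #|T|.-1) Q & forall k, phi k Q = 0].
  by apply: exists_bounded_degree_killed phiL _; rewrite cardC.
(* The minimal order exists because [S] is nonempty and a nonzero [Q] of bounded degree cannot
   vanish to every order at [x0]. *)
have [r [Sr [x xS xr]]] : exists r, (forall y, y \in S -> vanishing r (pt y) Q) /\
    exists2 x, x \in S & ~ vanishing r.+1 (pt x) Q.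
  apply: contrapT => /forallNP none; have all_r r y : y \in S -> vanishing r (pt y) Q.
    elim: r y => // r IH y yS; apply: contrapT => yr.
    by apply: (none r); split=> //; exists y.
  by move/eqP: Q0; apply; apply: vanishing_eq0 Qdeg (all_r _ _ x0S).
apply: xr; apply: vanishing_words (span x) _ => s sr; apply: contrapT => /eqP s0.
have count_lt j : (count_mem j s < K j)%N.
  set a := count_mem j s.
  pose g := dderivs (v x) [seq i <- s | i != j] Q.
  have sE := perm_nseq_rest j s; rewrite -/a in sE.
  (* [s] has length at most [r], so its letters other than [j] number at most r - a. *)
  have gS y : y \in S -> vanishing a (pt y) g.
    move=> yS; apply: vanishing_leq (vanishing_dderivs _ _ (Sr y yS)).
    by move: sr; rewrite (perm_size sE) size_cat size_nseq ltnS; move: (size _) => k; lia.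
  pose p := mmap (@polyC F) (c j (l j x)) g.
  have p0 : p != 0.
    apply: contraNneq s0 => p0.
    by rewrite (dderivs_perm _ _ sE) dderivs_cat dderivs_nseq; apply/eqP/tangent/gS.
  have [t tE] := choice (fun y => onc y j).
  pose fib := [set y in S | l j y == l j x]%SET.
  have := @size_exp_XsubC_dvdp F p [seq t y | y <- enum fib] a p0.
  rewrite size_map -cardE => roots.
  have {}roots : (a * #|fib| <= B * (n * #|T|.-1))%N.
    apply: leq_trans (roots _ _) _.
    - rewrite map_inj_in_uniq ?enum_uniq // => y z.
      rewrite !mem_enum !inE => /andP[_ /eqP yx] /andP[_ /eqP zx] yz.
      by apply/pt_inj/rowP => i; rewrite -!tE yz yx zx.
    - move=> _ /mapP[y + ->]; rewrite mem_enum inE => /andP[yS /eqP yx].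
      by apply: vanishing_dvdp (gS y yS) => i; rewrite -tE yx.
    - rewrite -subn1 leq_subLR add1n.
      exact: size_mmap_polyC (cB j _) (bounded_degree_dderivs Qdeg).
  have := fibS x j xS; rewrite card_ord -/fib => fibN.
  have Uj : (0 < #|U j|)%N by apply/card_gt0P; exists (l j x).
  (* The predecessor, coming from exponents at most N - 1 in [Q], yields the strict inequality a < K
     j. *)
  have : (a * #|T| <= K j * #|T|.-1)%N.
    apply: leq_trans (leq_mul (leqnn a) fibN) _.
    rewrite mulnCA (leq_trans (leq_mul (leqnn _) roots)) // /K.
    by rewrite (mulnC B) -!mulnA leq_mul2l; nia.
  have K0 : (0 < K j)%N by rewrite !muln_gt0 B0 Uj (leq_ltn_trans (leq0n j) (ltn_ord j)).
  by nia.
(* Up to order, [s] is now the word of a multi-index below [K], so its derivative at [x] is among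
   the conditions imposed on [Q]. *)
move/negP: s0; apply; rewrite (dderivs_perm _ _ (perm_word s)).
pose m : {dffun forall j, 'I_(K j)} := [ffun j => Ordinal (count_lt j)].
rewrite -(Qphi (x, m)) /phi /=; apply/eqP; congr (meval _ (dderivs _ _ _)).
by rewrite /word; congr flatten; apply: eq_map => j; rewrite ffunE.
Qed.

(** * Derivatives in tangent directions of arcs *)

Lemma bounded_degree_exists (F : numFieldType) (n : nat) (g : mpoly n F) :
  exists d, bounded_degree d g.
Proof.
exists (\max_(m <- msupp g) mdeg m)%N => m; rewrite -mcoeff_msupp => mg.
exact: leq_bigmax_seq.
Qed.

Definition line (F : numFieldType) (n : nat) (x w : 'rV[F]_n) (i : 'I_n) : {poly F} :=
  w 0 i *: 'X + (x 0 i)%:P.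

Lemma horner_line (F : numFieldType) (n : nat) (x w : 'rV[F]_n) i t :
  (line x w i).[t] = (x + t *: w) 0 i.
Proof. by rewrite /line !hornerE !mxE addrC mulrC. Qed.

(** Taylor coefficients of g (x + t w) at t = 0. *)
Lemma coef_mmap_line (F : numFieldType) (n k : nat) (x w : 'rV[F]_n) (g : mpoly n F) :
  (mmap (@polyC F) (line x w) g)`_k * k`!%:R = meval (x 0) (iter k (dderiv w) g).
Proof.
have D h : (mmap (@polyC F) (line x w) h)^`() = mmap (@polyC F) (line x w) (dderiv w h).
  rewrite deriv_mmap dderivE raddf_sum; apply: eq_bigr => i _ /=.
  by rewrite mmapZ /line derivD derivZ derivX derivC addr0 alg_polyC mulrC.
have Dk : (mmap (@polyC F) (line x w) g)^`(k) =
    mmap (@polyC F) (line x w) (iter k (dderiv w) g).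
  by elim: k => [|k IH]; rewrite ?derivn0 // derivnS IH D.
have := congr1 (fun p : {poly F} => p.[0]) Dk.
rewrite horner_coef0 coef_derivn addn0 ffactnn mulr_natr => ->.
by rewrite horner_mmap; apply: meval_eq => i; rewrite horner_line scale0r addr0.
Qed.

(** The value is polynomial in the coordinates of the direction, hence continuous; the induction
    peels off the innermost derivative. *)
Lemma cvg_meval_iter_dderiv (R : realType) (n k : nat) (x v : 'rV[R]_n)
    (w : R -> 'rV[R]_n) (g : mpoly n R) (G : set_system R) : Filter G ->
  w h @[h --> G] --> v ->
  meval (x 0) (iter k (dderiv (w h)) g) @[h --> G] --> meval (x 0) (iter k (dderiv v) g).
Proof.
move=> FG wv; elim: k g => [|k IH] g; first exact: cvg_cst.
have E u : meval (x 0) (iter k.+1 (dderiv u) g) =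
    \sum_i u 0 i * meval (x 0) (iter k (dderiv u) (mderiv i g)).
  have iterE h : iter k (dderiv u) h = dderivs (fun _ => u) (nseq k tt) h.
    by rewrite dderivs_nseq.
  rewrite iterSr dderivE !iterE (linear_sum (dderivs _ _)) raddf_sum.
  by apply: eq_bigr => i _; rewrite (linearZ_LR (dderivs _ _)) /= mevalZ iterE.
rewrite E; under eq_fun do rewrite E.
apply: cvg_big => [|i _]; first exact: add_continuous.
apply: cvgM; last exact: IH.
exact: (@cvg_comp _ _ _ w (fun M : 'rV[R]_n => M 0 i) G _ _ wv
  (@coord_continuous R 1 n 0 i v)).
Qed.

(* Along the arc, g (f h) = h ^ a * q (w h, h) where w h -> v is the difference
   quotient and q (w, 0) is the coefficient of t ^ a in g (x + t w). *)
Lemma tangent_vanishing (R : realType) (n a : nat) (x v : 'rV[R]_n)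
    (f : R -> 'rV[R]_n) (g : mpoly n R) :
  f 0 = x -> h^-1 *: (f h - f 0) @[h --> (0 : R)^'+] --> v ->
  (\forall h \near (0 : R)^'+, meval (f h 0) g = 0) ->
  vanishing a x g -> meval (x 0) (iter a (dderiv v) g) = 0.
Proof.
move=> f0; rewrite f0 => fv fg ga; pose w h := h^-1 *: (f h - x).
pose P u := mmap (@polyC R) (line x u) g.
(* [d] bounds the degree of [P u] for all [u] at once, so [q] has a fixed number of terms and its
   limit can be taken termwise. *)
have [d gd] := bounded_degree_exists g.
pose q (h : R) := \sum_(k < d.+1) (P (w h))`_(k + a) * h ^+ k.
have PE u : P u = drop_poly a (P u) * 'X^a.
  rewrite -[LHS](poly_take_drop a) (_ : take_poly a _ = 0) ?add0r //.
  apply/polyP => k; rewrite coef_take_poly coef0; case: ltnP => // ka.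
  have : 'X^a %| P u.
    rewrite -['X]subr0; apply: vanishing_dvdp ga => i.
    by rewrite horner_line scale0r addr0.
  by case/dvdpP => r ->; rewrite coefMXn ka.
have q0 : \forall h \near (0 : R)^'+, q h = 0.
  near=> h; have h0 : h != 0 by apply: lt0r_neq0; near: h; exact: nbhs_right_gt.
  have : (P (w h)).[h] = 0.
    rewrite horner_mmap -[RHS](_ : meval (f h 0) g = 0); last by near: h.
    by apply: meval_eq => i; rewrite horner_line scalerA divff // scale1r addrC subrK.
  rewrite PE hornerM hornerXn => /eqP.
  rewrite mulf_eq0 expf_eq0 (negbTE h0) andbF orbF => /eqP.
  rewrite (@horner_coef_wide _ d.+1) => [<-|].
    by apply: eq_bigr => k _; rewrite coef_drop_poly.
  rewrite size_drop_poly (leq_trans (leq_subr _ _)) // -[d in leqRHS]mul1n.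
  apply: size_mmap_polyC gd => i.
  rewrite (leq_trans (size_polyD _ _)) // geq_max.
  by rewrite (leq_trans (size_scale_leq _ _)) ?size_polyX //= size_polyC; case: eqP.
have q1 : q h @[h --> (0 : R)^'+] --> \sum_(k < d.+1) (P v)`_(k + a) * (0 : R) ^+ k.
  apply: cvg_big => [|k _]; first exact: add_continuous.
  have PK u : (P u)`_(k + a) = meval (x 0) (iter (k + a) (dderiv u) g) / ((k + a)`!)%:R.
    by rewrite -coef_mmap_line mulfK // pnatr_eq0 -lt0n fact_gt0.
  rewrite PK; under eq_fun do rewrite PK.
  apply: cvgM.
    by apply: cvgM; [exact: cvg_meval_iter_dderiv|exact: cvg_cst].
  by apply: cvg_at_right_filter; exact: exprn_continuous.
have : \sum_(k < d.+1) (P v)`_(k + a) * (0 : R) ^+ k = 0.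
  have : q h @[h --> (0 : R)^'+] --> (0 : R).
    by apply: cvg_near_cst q0.
  by move=> /(cvg_unique _ q1) ->.
rewrite big_ord_recl expr0 mulr1 add0n big1 ?addr0 => [|k _]; last by rewrite expr0n mulr0.
by rewrite -coef_mmap_line => ->; rewrite mul0r.
Unshelve. all: by end_near.
Qed.

(** * Multijoints of polynomial curves *)

Lemma span_row_combination (F : fieldType) (n : nat) (v : 'I_n -> 'rV[F]_n) :
  (<<[seq v i | i <- enum 'I_n]>> = fullv)%VS ->
  forall w, exists a : 'I_n -> F, w = \sum_i a i *: v i.
Proof.
move=> vfull w; have : w \in <<[seq v i | i <- enum 'I_n]>>%VS by rewrite vfull memvf.
have E : [seq v i | i <- enum 'I_n] = mktuple v by [].
rewrite E => /coord_span ->; exists (fun i => coord (mktuple v) i w).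
by apply: eq_bigr => i _; rewrite -tnth_nth tnth_mktuple.
Qed.

(** Directions and curves are packed into one pair so that a single choice over the points supplies
    both. *)
Lemma multijoint_tangent_curves (R : realType) (Gamma : 'I_3 -> set (set 'rV[R]_3))
    (x : 'rV[R]_3) :
  (forall j, finite_set (Gamma j)) -> multijoint Gamma x ->
  exists vl : ('I_3 -> 'rV[R]_3) * (forall j, fset_set (Gamma j)),
    (forall w, exists a : 'I_3 -> R, w = \sum_i a i *: vl.1 i) /\
    forall j, val (vl.2 j) x /\ tangent_direction (val (vl.2 j)) x (vl.1 j).
Proof.
move=> finG [_ [v tanv vfull]].
have gam j : exists g : fset_set (Gamma j), val g x /\ tangent_direction (val g) x (v j).
  have [g [Gg gx tg]] := tanv j.
  have gin : g \in fset_set (Gamma j) by rewrite in_fset_set // inE.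
  by exists [` gin]%fset.
exists (v, fun j => projT1 (cid (gam j))); split; first exact: span_row_combination.
by move=> j; exact: (projT2 (cid (gam j))).
Qed.

(** The arc [f] may be parametrised quite differently from [c], but it stays in [gamma], where [g]
    vanishes because g o c = 0. *)
Lemma polynomial_curve_tangent (R : realType) (c : 'I_3 -> {poly R})
    (gamma : set 'rV[R]_3) (x v : 'rV[R]_3) (a : nat) (g : mpoly 3 R) :
  gamma = range (fun t => \row_i (c i).[t]) -> tangent_direction gamma x v ->
  mmap (@polyC R) c g = 0 -> vanishing a x g ->
  meval (x 0) (iter a (dderiv v) g) = 0.
Proof.
move=> gammaE [_ [Cs [C [f [[_ _ Csg _] CsC [f0 fC _ _] fv]]]]] cg.
apply: tangent_vanishing f0 fv _.
near=> h.
have : gamma (f h).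
  apply: Csg; exists C => //; rewrite -fC; exists h => //=.
  rewrite in_itv /=; apply/andP; split.
    by apply: ltW; near: h; exact: nbhs_right_gt.
  by near: h; exact: nbhs_right_lt.
rewrite gammaE => -[t _ <-].
rewrite (@meval_eq _ _ _ (fun i => (c i).[t])) => [|i]; last by rewrite mxE.
by rewrite -horner_mmap cg horner0.
Unshelve. all: by end_near.
Qed.

(** Stated for finite sets of multijoints, since the finiteness of the set of all multijoints is
    deduced from this bound. *)
Lemma card_multijoints_le (R : realType) (B : nat) (Gamma : 'I_3 -> set (set 'rV[R]_3))
    (S : {fset 'rV[R]_3}) :
  (0 < B)%N -> (forall j, finite_set (Gamma j)) ->
  (forall j gamma, Gamma j gamma -> polynomial_curve B%:R gamma) ->
  [set` S] `<=` multijoint Gamma ->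
  (#|` S| ^ 2 <= (12 * B) ^ 3 * \prod_(j < 3) #|` fset_set (Gamma j)|)%N.
Proof.
move=> B0 finG polyG SJ.
have [->|S0] := posnP #|` S|; first by [].
have [vl vlP] := choice (fun y : S => multijoint_tangent_curves finG (SJ _ (valP y))).
have curve j (u : fset_set (Gamma j)) : polynomial_curve B%:R (val u).
  by apply: polyG; apply: set_mem; rewrite -in_fset_set //; exact: (valP u).
pose c j u := projT1 (cid (curve j u)).
have cP j u : [/\ val u = range (fun t : R => \row_i (c j u i).[t]),
    ~ (forall i, exists a : R, c j u i = a%:P) &
    forall i, ((size (c j u i)).-1)%:R <= B%:R :> R] := projT2 (cid (curve j u)).
have := @joints_core R 3 B S (fun j => fset_set (Gamma j)) (fun j x => (vl x).2 j)
  val (fun x => (vl x).1) c B0.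
rewrite -cardfE => /(_ S0 val_inj) core.
have {}core : (#|` S| ^ 3 <=
    #|` S| * \prod_(j < 3) (4 * 3 * B * #|{: fset_set (Gamma j)}|))%N.
  apply: core.
  - move=> j u i; have [_ _ /(_ i)] := cP j u; rewrite ler_nat.
    by case: (size _).
  - by move=> x; exact: (vlP x).1.
  - move=> x j; have [+ _ _] := cP j ((vl x).2 j); have [+ _] := (vlP x).2 j.
    by move=> + uE; rewrite uE => -[t _ tx]; exists t => i; rewrite -tx mxE.
  - move=> x j a g; have [uE _ _] := cP j ((vl x).2 j).
    by apply: polynomial_curve_tangent uE _; exact: ((vlP x).2 j).2.
(* One factor |S| > 0 cancels; 12 is (n+1) n for n = 3. *)
move: core; rewrite expnS leq_pmul2l //.
rewrite big_split prod_nat_const card_ord /=.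
by under eq_bigr do rewrite -cardfE.
Qed.

Theorem corollary6p2p4 (R : realType) (b : R) (hb : 0 < b) :
  exists c : R,
    forall Gamma : 'I_3 -> set (set 'rV[R]_3),
      (forall j, finite_set (Gamma j)) ->
      (forall j gamma, Gamma j gamma -> polynomial_curve b gamma) ->
      let J := [set x | multijoint Gamma x] in
      finite_set J /\
      (#|` fset_set J|)%:R <=
        c * Num.sqrt (\prod_(j < 3) (#|` fset_set (Gamma j)|)%:R).
Proof.
pose B := Num.bound b.
have bB : b < B%:R by apply: archi_boundP; exact: ltW.
have B0 : (0 < B)%N by rewrite -(ltr0n R); exact: lt_trans bB.
exists (Num.sqrt ((12 * B) ^ 3)%:R) => Gamma finG polyG J.
have bound S : [set` S] `<=` J ->
    (#|` S| ^ 2 <= (12 * B) ^ 3 * \prod_(j < 3) #|` fset_set (Gamma j)|)%N.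
  apply: card_multijoints_le => // j gamma /polyG[p [-> pc pb]].
  by exists p; split=> // i; exact: le_trans (pb i) (ltW bB).
(* An infinite [J] would contain a finite set of at least N + 1 points, whose square exceeds the
   bound N. *)
have finJ : finite_set J.
  pose N := ((12 * B) ^ 3 * \prod_(j < 3) #|` fset_set (Gamma j)|)%N.
  apply: contrapT => /infinite_set_fset-/(_ N.+1); rewrite /N => -[S /bound]; nia.
split=> //; have := bound (fset_set J); rewrite fset_setK // => /(_ (@subset_refl _ _)).
rewrite -(ler_nat R) natrX natrM natr_prod => /ler_wsqrtr.
by rewrite sqrtr_sqr ger0_norm // sqrtrM.
Qed.
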